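(* Let $A,P\in\mathbb{R}^{n\times n}$ be invertible, $b\in\mathbb{R}^n$, and consider AAg($m$) used to accelerate the preconditioned Richardson iteration $q(x)=x+P(b-Ax)$ for solving $g(x)=Ax-b=0$. Let $H=I-AP$ and $\bar r_k=Ax_k-b$. Then for every $k\ge0$ the least-squares problem defining $\boldsymbol{\alpha}^{(k)}$ can be rewritten as $$\min_{\boldsymbol{\alpha}^{(k)}}\|\bar r_{k+1}\|^2=\min_{\boldsymbol{\alpha}^{(k)}}\|H(\bar r_k-\bar R_k\boldsymbol{\alpha}^{(k)})\|^2,$$ i.e. for every coefficient vector $\boldsymbol{\alpha}^{(k)}$ its objective equals $\|\bar r_{k+1}\|^2$ (with $x_{k+1}$, hence $\bar r_{k+1}$, regarded as a function of $\boldsymbol{\alpha}^{(k)}$) and equals $\|H(\bar r_k-\bar R_k\boldsymbol{\alpha}^{(k)})\|^2$, where $$\bar R_k=[\,\bar r_{k-1}-\bar r_k,\ \bar r_{k-2}-\bar r_k,\ \dots,\ \bar r_{k-m_k}-\bar r_k\,].$$ For the iterates generated by AAg($m$) and all $i,j=0,1,\dots,m_k$, $$\bar r_{k+1}^TH(\bar r_{k-j}-\bar r_{k-i})=0,\qquad \|\bar r_{k+1}\|\le\|H\bar r_k\|.$$ Moreover, if $\|H\|<1$, then $\|\bar r_{k+1}\|<\|\bar r_k\|$ for every $k$ with $\bar r_k\ne0$, and AAg($m$) converges, i.e. $x_k\to A^{-1}b$.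
   Context: $\|\cdot\|$ is the 2-norm for vectors and matrices. AAg($m$), $m\ge0$ an integer: given $x_0\in\mathbb{R}^n$, for $k=0,1,2,\dots$ let $m_k=\min\{k,m\}$ and set $$x_{k+1}=q(x_k)+\sum_{i=1}^{m_k}\alpha_i^{(k)}\big(q(x_k)-q(x_{k-i})\big),$$ where $\boldsymbol{\alpha}^{(k)}=(\alpha_1^{(k)},\dots,\alpha_{m_k}^{(k)})\in\mathbb{R}^{m_k}$ is obtained by solving the least-squares problem $$\min_{\boldsymbol{\alpha}^{(k)}}\Big\|g(q(x_k))+\sum_{i=1}^{m_k}\alpha_i^{(k)}\big(g(q(x_k))-g(q(x_{k-i}))\big)\Big\|^2 .$$ When $m_k=0$ the sums are empty. *)

(* Defs.v *)
From mathcomp Require Import all_boot all_order all_algebra.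
From mathcomp Require Import all_classical all_reals all_analysis.
Import Order.TTheory GRing.Theory Num.Theory.
Import numFieldNormedType.Exports.

Set Implicit Arguments.
Unset Strict Implicit.
Unset Printing Implicit Defensive.

Local Open Scope classical_set_scope.
Local Open Scope ring_scope.

(* The library norm [`|_|] on matrices is the max norm, hence the two
   definitions below. *)
Definition norm2 (R : realType) (n : nat) (v : 'cV[R]_n) : R :=
  Num.sqrt (\sum_i v i 0 ^+ 2).

(* The norm on matrices induced by [norm2]. *)
Definition mxnorm2 (R : realType) (p n : nat) (M : 'M[R]_(p, n)) : R :=
  sup [set norm2 (M *m v) | v in [set v : 'cV[R]_n | norm2 v <= 1]].

(* In the sums below i is 0-based: a i 0 is the mathematical alpha_{i+1}, paired
   with the iterate x_{k-(i+1)}; as i < minn k m <= k, the truncated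
   subtraction is exact. *)
Definition aag_next (R : realType) (n : nat) (q : 'cV[R]_n -> 'cV[R]_n)
    (m : nat) (x : nat -> 'cV[R]_n) (k : nat) (a : 'cV[R]_(minn k m)) :
    'cV[R]_n :=
  q (x k) + \sum_(i < minn k m) a i 0 *: (q (x k) - q (x (k - i.+1)%N)).
Arguments aag_next {R n} q m x k a.

Definition aag_objective (R : realType) (n : nat) (q g : 'cV[R]_n -> 'cV[R]_n)
    (m : nat) (x : nat -> 'cV[R]_n) (k : nat) (a : 'cV[R]_(minn k m)) : R :=
  norm2 (g (q (x k)) +
         \sum_(i < minn k m)
           a i 0 *: (g (q (x k)) - g (q (x (k - i.+1)%N)))) ^+ 2.
Arguments aag_objective {R n} q g m x k a.

(* The least-squares solution need not be unique: alpha k is any minimizer. *)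
Definition is_AAg (R : realType) (n : nat) (q g : 'cV[R]_n -> 'cV[R]_n)
    (m : nat) (x0 : 'cV[R]_n) (x : nat -> 'cV[R]_n)
    (alpha : forall k : nat, 'cV[R]_(minn k m)) : Prop :=
  x 0%N = x0 /\
  forall k : nat,
    (forall a : 'cV[R]_(minn k m),
        aag_objective q g m x k (alpha k) <= aag_objective q g m x k a) /\
    x k.+1 = aag_next q m x k (alpha k).
Arguments is_AAg {R n} q g m x0 x alpha.

Definition richardson (R : realType) (n : nat) (A P : 'M[R]_n) (b : 'cV[R]_n)
    (x : 'cV[R]_n) : 'cV[R]_n :=
  x + P *m (b - A *m x).

Definition residual (R : realType) (n : nat) (A : 'M[R]_n) (b : 'cV[R]_n)
    (x : 'cV[R]_n) : 'cV[R]_n :=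
  A *m x - b.

Definition residual_diffs (R : realType) (n m : nat) (r : nat -> 'cV[R]_n)
    (k : nat) : 'M[R]_(n, minn k m) :=
  \matrix_(i < n, j < minn k m) (r (k - j.+1)%N - r k) i 0.

(* Main.v *)
Require Import Defs.
From mathcomp Require Import all_boot all_order all_algebra.
From mathcomp Require Import all_classical all_reals all_analysis.
From mathcomp Require Import ring lra.
Import Order.TTheory GRing.Theory Num.Theory.
Import numFieldNormedType.Exports.

Set Implicit Arguments.
Unset Strict Implicit.
Unset Printing Implicit Defensive.

Local Open Scope classical_set_scope.
Local Open Scope ring_scope.

(** Since [A q(x) - b = H (A x - b)], the map [q] acts on residuals as the
    linear map [H].  The new iterate is an affine combination of the points
    [q(x_(k-i))] (the weights sum to one), so its residual is the same affine
    combination of the [H r_(k-i)], that is [H (r_k - R_k a)].  This is at once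
    the vector whose norm the least-squares problem minimizes
    ([aag_objectiveE], [residual_aag_next]).

    The rest is the geometry of least squares.  At a minimizer the residual is
    orthogonal to every direction in which the coefficients can be moved
    ([orthogonal_of_minimal_norm2]); these directions are the vectors
    [H (r_(k-i) - r_k)], and subtracting two of them gives the orthogonality
    relations.  Comparing the minimizer with [a = 0], which is one plain
    Richardson step, gives [|r_(k+1)| <= |H r_k|].

    If [|H| < 1], the last bound is a contraction, so the residuals decay
    geometrically, and [x_k - A^-1 b = A^-1 r_k] tends to zero with them.  The
    only analytic point is that the supremum defining the induced norm is
    finite ([has_ubound_mxnorm2]), without which it would not bound
    anything. *)

(** * The Euclidean norm and its induced matrix norm *)

Section EuclideanNorm.
Variable R : realType.

Lemma norm2_ge0 n (v : 'cV[R]_n) : 0 <= norm2 v.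
Proof. exact: sqrtr_ge0. Qed.

Lemma norm2_sqr n (v : 'cV[R]_n) : norm2 v ^+ 2 = \sum_i v i 0 ^+ 2.
Proof. by rewrite sqr_sqrtr// sumr_ge0// => i _; exact: sqr_ge0. Qed.

Lemma norm2_le n p (v : 'cV[R]_n) (w : 'cV[R]_p) :
  norm2 v ^+ 2 <= norm2 w ^+ 2 -> norm2 v <= norm2 w.
Proof. by rewrite ler_pXn2r// nnegrE norm2_ge0. Qed.

Lemma norm2_gt0 n (v : 'cV[R]_n) : v != 0 -> 0 < norm2 v.
Proof.
apply: contraNT; rewrite -leNgt => v_le0.
have v0 : norm2 v ^+ 2 = 0.
  by rewrite (_ : norm2 v = 0) ?expr0n//; apply/eqP; rewrite eq_le v_le0 norm2_ge0.
apply/eqP/matrixP => i j; rewrite ord1 mxE; apply/eqP.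
move: v0; rewrite norm2_sqr => /psumr_eq0P => /(_ (fun i _ => sqr_ge0 _)) /(_ i erefl).
by move/eqP; rewrite sqrf_eq0.
Qed.

Lemma norm2Z n (c : R) (v : 'cV[R]_n) : norm2 (c *: v) = `|c| * norm2 v.
Proof.
rewrite /norm2 -sqrtr_sqr -sqrtrM ?sqr_ge0// mulr_sumr.
by congr Num.sqrt; apply: eq_bigr => i _; rewrite mxE exprMn.
Qed.

Lemma norm2_0 n : norm2 (0 : 'cV[R]_n) = 0.
Proof. by rewrite -(scale0r 0) norm2Z normr0 mul0r. Qed.

Lemma ler_entry_norm2 n (v : 'cV[R]_n) i : `|v i 0| <= norm2 v.
Proof.
rewrite -sqrtr_sqr ler_wsqrtr// (bigD1 i)//= lerDl.
by apply: sumr_ge0 => j _; exact: sqr_ge0.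
Qed.

(** On the unit ball every entry of [v] is at most one in absolute value, so
    each entry of [M *m v] is bounded by an absolute row sum of [M]; this crude
    estimate is enough for finiteness. *)
Lemma has_ubound_mxnorm2 p n (M : 'M[R]_(p, n)) :
  has_ubound [set norm2 (M *m v) | v in [set v : 'cV[R]_n | norm2 v <= 1]].
Proof.
exists (norm2 (\col_i \sum_j `|M i j|)) => _ [v /= v_le1 <-].
apply: norm2_le; rewrite !norm2_sqr; apply: ler_sum => i _.
rewrite -[X in X <= _]real_normK ?num_real// ler_pXn2r ?nnegrE ?normr_ge0//.
  rewrite !mxE (le_trans (ler_norm_sum _ _ _))// ler_sum// => j _.
  by rewrite normrM ler_piMr// (le_trans (ler_entry_norm2 v j)).
by rewrite mxE sumr_ge0.
Qed.

Lemma norm2_mulmx p n (M : 'M[R]_(p, n)) (v : 'cV[R]_n) :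
  norm2 (M *m v) <= mxnorm2 M * norm2 v.
Proof.
have [->|/norm2_gt0 v_gt0] := eqVneq v 0; first by rewrite mulmx0 !norm2_0 mulr0.
rewrite -ler_pdivrMr// mulrC -[X in X * _]ger0_norm ?invr_ge0 ?norm2_ge0//.
rewrite -norm2Z scalemxAr; apply: ub_le_sup; first exact: has_ubound_mxnorm2.
exists ((norm2 v)^-1 *: v) => //=.
by rewrite norm2Z ger0_norm ?invr_ge0 ?norm2_ge0// mulVf// gt_eqF.
Qed.

Lemma mxnorm2_ge0 p n (M : 'M[R]_(p, n)) : 0 <= mxnorm2 M.
Proof.
apply: ub_le_sup; first exact: has_ubound_mxnorm2.
by exists 0; rewrite /= ?mulmx0 norm2_0.
Qed.

(** First-order optimality without calculus: with [s = <u, v>] and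
    [w = |v|^2], minimality says [0 <= 2 t s + t^2 w] for every [t], and a
    suitable [t] of sign opposite to [s] makes the right-hand side negative
    unless [s = 0]. *)
Lemma orthogonal_of_minimal_norm2 n (u v : 'cV[R]_n) :
  (forall t, norm2 u ^+ 2 <= norm2 (u + t *: v) ^+ 2) -> u^T *m v = 0.
Proof.
move=> u_min; apply/matrixP => i j; rewrite !ord1 [RHS]mxE {i j}.
set s := (u^T *m v) 0 0; pose w := norm2 v ^+ 2.
have w_ge0 : 0 <= w by exact: sqr_ge0.
have quad_ge0 t : 0 <= 2 * t * s + t ^+ 2 * w.
  have := u_min t; rewrite -subr_ge0; congr (0 <= _).
  rewrite /w /s !norm2_sqr !mxE !mulr_sumr -sumrB -big_split/=.
  by apply: eq_bigr => i _; rewrite !mxE; ring.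
(* The minimum of the quadratic is at [- s / w]; the denominator [w + 1] avoids
   a separate case for [v = 0]. *)
have := quad_ge0 (- (s / (w + 1))).
have w1_gt0 : 0 < w + 1 by lra.
have -> : 2 * - (s / (w + 1)) * s + (- (s / (w + 1))) ^+ 2 * w =
          - ((s / (w + 1)) ^+ 2 * (w + 2)) by field; lra.
rewrite oppr_ge0 pmulr_lle0; last by lra.
move=> s_le0; have : (s / (w + 1)) ^+ 2 == 0 by rewrite eq_le s_le0 sqr_ge0.
by rewrite sqrf_eq0 mulf_eq0 invr_eq0 (gt_eqF w1_gt0) orbF => /eqP.
Qed.

End EuclideanNorm.

(** The topology on matrices is that of entrywise balls, so the Euclidean bound
    is used one entry at a time. *)
Lemma cvg_of_norm2_geometric (R : realType) n (u : nat -> 'cV[R]_n) (c C : R)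
    (l : 'cV[R]_n) :
  0 <= c < 1 -> (forall k, norm2 (u k - l) <= C * c ^+ k) -> u @ \oo --> l.
Proof.
move=> /andP[c_ge0 c_lt1] u_le.
have cvgC : (fun k => C * c ^+ k) @ \oo --> (0 : R).
  rewrite -(mulr0 C); apply: cvgMr; apply: cvg_expr.
  by rewrite ger0_norm.
apply/cvg_ballP => e e_gt0.
have /cvgrPdist_lt /(_ _ e_gt0) := cvgC.
apply: filterS => k; rewrite sub0r normrN => Ce_lt; split=> // i j.
rewrite ord1 -ball_normE/= distrC.
have := ler_entry_norm2 (u k - l) i; rewrite !mxE => /le_lt_trans; apply.
by apply: le_lt_trans (u_le k) _; apply: le_lt_trans Ce_lt; exact: ler_norm.
Qed.

(** * Residuals of the accelerated iteration *)

Section Residuals.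
Variables (R : realType) (n m : nat) (A P : 'M[R]_n) (b : 'cV[R]_n).
Let q := richardson A P b.
Let g := residual A b.
Let H : 'M[R]_n := 1%:M - A *m P.

Lemma residual_richardson y : g (q y) = H *m g y.
Proof.
rewrite /g /q /H /residual /richardson [RHS]mulmxBl mul1mx -mulmxA.
by rewrite [A *m (y + _)]mulmxDr -[b - A *m y]opprB !mulmxN addrAC.
Qed.

Lemma residualB y z : g y - g z = A *m (y - z).
Proof. by rewrite /g /residual opprB addrA subrK mulmxBr. Qed.

Variables (x : nat -> 'cV[R]_n) (k : nat).
Let r j : 'cV[R]_n := A *m x j - b.

Lemma residual_diffs_mul (a : 'cV[R]_(minn k m)) :
  residual_diffs m r k *m a =
  \sum_(i < minn k m) a i 0 *: (r (k - i.+1)%N - r k).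
Proof.
apply/matrixP => i j; rewrite ord1 !mxE summxE; apply: eq_bigr => l _.
by rewrite !mxE mulrC.
Qed.

Lemma objective_residual (a : 'cV[R]_(minn k m)) :
  g (q (x k)) + \sum_(i < minn k m) a i 0 *: (g (q (x k)) - g (q (x (k - i.+1)%N)))
  = H *m (r k - residual_diffs m r k *m a).
Proof.
rewrite residual_diffs_mul mulmxBr residual_richardson -[g (x k)]/(r k).
rewrite mulmx_sumr -sumrN; congr (_ + _); apply: eq_bigr => i _.
by rewrite residual_richardson -mulmxBr -scalemxAr -scalerN -mulmxN [- (_ - r k)]opprB.
Qed.

Lemma residual_aag_next (a : 'cV[R]_(minn k m)) :
  A *m aag_next q m x k a - b = H *m (r k - residual_diffs m r k *m a).
Proof.
rewrite -objective_residual /aag_next mulmxDr addrAC; congr (_ + _).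
by rewrite mulmx_sumr; apply: eq_bigr => i _; rewrite -scalemxAr residualB.
Qed.

Lemma aag_objectiveE (a : 'cV[R]_(minn k m)) :
  aag_objective q g m x k a =
  norm2 (H *m (r k - residual_diffs m r k *m a)) ^+ 2.
Proof. by rewrite /aag_objective objective_residual. Qed.

End Residuals.

Theorem theorem3p1 (R : realType) (n m : nat) (A P : 'M[R]_n) (b : 'cV[R]_n)
    (hA : A \in unitmx) (hP : P \in unitmx)
    (x0 : 'cV[R]_n) (x : nat -> 'cV[R]_n)
    (alpha : forall k : nat, 'cV[R]_(minn k m))
    (hx : is_AAg (richardson A P b) (residual A b) m x0 x alpha) :
  let q := richardson A P b in
  let g := residual A b in
  let H := 1%:M - A *m P in
  let r := fun k : nat => A *m x k - b in
  (forall (k : nat) (a : 'cV[R]_(minn k m)),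
      aag_objective q g m x k a = norm2 (A *m aag_next q m x k a - b) ^+ 2 /\
      aag_objective q g m x k a =
        norm2 (H *m (r k - residual_diffs m r k *m a)) ^+ 2) /\
  (forall k i j : nat, (i <= minn k m)%N -> (j <= minn k m)%N ->
      (r k.+1)^T *m H *m (r (k - j)%N - r (k - i)%N) = 0) /\
  (forall k : nat, norm2 (r k.+1) <= norm2 (H *m r k)) /\
  (mxnorm2 H < 1 ->
      (forall k : nat, r k != 0 -> norm2 (r k.+1) < norm2 (r k)) /\
      x @ \oo --> invmx A *m b).
Proof.
move=> q g H r; case: hx => _ hx.
have rS k : r k.+1 = H *m (r k - residual_diffs m r k *m alpha k).
  by rewrite /r (hx k).2 residual_aag_next.
have r_min k a :
    norm2 (r k.+1) ^+ 2 <= norm2 (H *m (r k - residual_diffs m r k *m a)) ^+ 2.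
  by rewrite rS -!aag_objectiveE; exact: (hx k).1.
have r_orth k i : (i <= minn k m)%N ->
    (r k.+1)^T *m H *m (r (k - i)%N - r k) = 0.
  case: i => [|i] i_le; first by rewrite subn0 subrr mulmx0.
  rewrite -mulmxA; apply: orthogonal_of_minimal_norm2 => t.
  (* Moving the coefficient of [x_(k-i-1)] by [- t] moves the residual by [t]
     times the vector to which it is claimed to be orthogonal. *)
  apply: le_trans (r_min k (alpha k - t *: delta_mx (Ordinal i_le) 0)) _.
  set D := residual_diffs m r k.
  suff -> : H *m (r k - D *m (alpha k - t *: delta_mx (Ordinal i_le) 0)) =
            r k.+1 + t *: (H *m (r (k - i.+1)%N - r k)) by [].
  rewrite rS -/D scalemxAr -mulmxDr; congr (_ *m _).
  rewrite mulmxBr opprB addrA addrAC -scalemxAr -colE; congr (_ + _ *: _).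
  by apply/matrixP => p p'; rewrite ord1 !mxE.
have r_le k : norm2 (r k.+1) <= norm2 (H *m r k).
  by apply: norm2_le; have := r_min k 0; rewrite mulmx0 subr0.
split; first by move=> k a; rewrite residual_aag_next -aag_objectiveE.
split.
  move=> k i j i_le j_le.
  rewrite -[r (k - j)%N](subrK (r k)) -addrA -[r k - _]opprB mulmxBr.
  by rewrite !r_orth// subrr.
split=> // H_lt1.
have r_leM k : norm2 (r k.+1) <= mxnorm2 H * norm2 (r k).
  exact: le_trans (r_le k) (norm2_mulmx _ _).
split.
  move=> k rk_neq0; apply: le_lt_trans (r_leM k) _.
  by rewrite gtr_pMl// norm2_gt0.
have r_geom k : norm2 (r k) <= mxnorm2 H ^+ k * norm2 (r 0%N).
  elim: k => [|k IHk]; first by rewrite expr0 mul1r.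
  apply: le_trans (r_leM k) _.
  by rewrite exprS -mulrA ler_wpM2l// mxnorm2_ge0.
apply: (@cvg_of_norm2_geometric _ _ _ (mxnorm2 H) (mxnorm2 (invmx A) * norm2 (r 0%N))).
  by rewrite mxnorm2_ge0.
move=> k.
have -> : x k - invmx A *m b = invmx A *m r k.
  by rewrite /r mulmxBr mulmxA mulVmx// mul1mx.
apply: le_trans (norm2_mulmx _ _) _.
by rewrite -mulrA ler_wpM2l ?mxnorm2_ge0// [leRHS]mulrC.
Qed.
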